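(* Let $n \ge 1$ and let $G$ be a permutation group acting on $[n]$ (a subgroup of $\operatorname{Sym}([n])$). Then the orbit condition is sufficient for the $G$-Marriage Problem if and only if $G$ is a direct product of symmetric groups.
   Context: $[n]=\{1,\ldots,n\}$, and $\operatorname{Sym}(\Omega)$ denotes the group of all permutations of a finite set $\Omega$. A system $\mathcal{V}$ of $n$ subsets of $[n]$ is an indexed family $V_1,\ldots,V_n$ with each $V_i\subseteq [n]$ (arbitrary subsets). $G$ has a $G$-marriage subject to $\mathcal{V}$ if there exists $g\in G$ with $g(i)\in V_i$ for every $i\in[n]$. $G$ satisfies the orbit condition subject to $\mathcal{V}$ if for every non-empty $Y\subseteq[n]$ there exists $g\in G$ (which may depend on $Y$) such that $Y^g=\{g(y): y\in Y\}\subseteq \bigcup_{y\in Y}V_y$. ''The orbit condition is sufficient for the $G$-Marriage Problem'' means: for every system $\mathcal{V}$ of $n$ subsets of $[n]$, if $G$ satisfies the orbit condition subject to $\mathcal{V}$, then $G$ has a $G$-marriage subject to $\mathcal{V}$. ''$G$ is a direct product of symmetric groups'' means: there is a partition $[n]=\Omega_1\cup\cdots\cup\Omega_m$ into disjoint non-empty sets such that $G=\operatorname{Sym}(\Omega_1)\times\cdots\times\operatorname{Sym}(\Omega_m)$ as a subgroup of $\operatorname{Sym}([n])$, i.e. $G$ consists of exactly those permutations $g$ of $[n]$ with $g(\Omega_i)=\Omega_i$ for all $i$. *)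

(* Defs.v *)
From mathcomp Require Import all_boot all_fingroup.

Set Implicit Arguments.
Unset Strict Implicit.
Unset Printing Implicit Defensive.

(* [n] = {1, ..., n} is rendered as 'I_n = {0, ..., n - 1}, and a system of n
   subsets of [n] is an arbitrary family V : 'I_n -> {set 'I_n}. *)

Definition has_marriage (n : nat) (G : {group 'S_n})
    (V : 'I_n -> {set 'I_n}) : Prop :=
  exists2 g : 'S_n, g \in G & forall i : 'I_n, g i \in V i.

Definition orbit_condition (n : nat) (G : {group 'S_n})
    (V : 'I_n -> {set 'I_n}) : Prop :=
  forall Y : {set 'I_n}, Y != set0 ->
    exists2 g : 'S_n, g \in G & [set g y | y in Y] \subset \bigcup_(y in Y) V y.

Definition orbit_condition_sufficient (n : nat) (G : {group 'S_n}) : Prop :=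
  forall V : 'I_n -> {set 'I_n}, orbit_condition G V -> has_marriage G V.

(* In finset, [partition P D] includes that the blocks of P are non-empty. *)
Definition is_product_of_symmetric_groups (n : nat) (G : {group 'S_n}) : Prop :=
  exists2 P : {set {set 'I_n}}, partition P [set: 'I_n] &
    forall g : 'S_n,
      g \in G <-> (forall Omega : {set 'I_n}, Omega \in P ->
                     [set g x | x in Omega] = Omega).

(* Main.v *)
Require Import Defs.
From mathcomp Require Import all_boot all_fingroup.

(** Products of symmetric groups satisfy the marriage property by Hall's theorem
    ([hall_marriage]): a marriage that respects the blocks is a system of
    distinct representatives of the sets [V i :&: pblock P i], and the orbit
    condition, tested on the traces of [Y] on the blocks, gives Hall's
    inequality for [Y] after summation over the blocks.

    Conversely, assume that the orbit condition suffices for [G].  It is enough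
    to show that [G] contains the transposition of any two points of a common
    orbit ([tperm_orbit_sufficient]), because these transpositions generate all
    permutations that preserve the orbits ([mem_of_tperm_orbit]).  Each of the
    two steps is one system of subsets for which the orbit condition holds but a
    marriage is impossible.
    - A point [a] moved by [G] is moved by a transposition of [G]
      ([exists_tperm_sufficient]): among the elements of [G] that move [a], one
      with the most fixed points has to be a transposition.
    - Let [a] and [a'] be exchanged by a transposition of [G].  The relation
      that [tperm x y \in G] is a [G]-invariant equivalence; if its class of [a]
      were not the whole orbit, the system forbidding the value [a] on that
      class and the value [a'] elsewhere would have no marriage. *)

Set Implicit Arguments.
Unset Strict Implicit.
Unset Printing Implicit Defensive.

Import GroupScope.

(** Rado's argument: as long as some [W i] has two elements, one of them can be
    deleted without losing Hall's inequality.  If the deletions of [x] and of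
    [y] fail at [A] and [B], then both contain [i], and submodularity of the
    size of the unions contradicts Hall's inequality for [A :|: B] and
    [(A :&: B) :\ i].  In the end, all [W i] are singletons. *)
Lemma hall_marriage (I T : finType) (W : I -> {set T}) :
    (forall Y : {set I}, #|Y| <= #|\bigcup_(y in Y) W y|) ->
  exists2 f : I -> T, injective f & forall i, f i \in W i.
Proof.
have [m] := ubnP (\sum_i #|W i|).
elim: m W => // m IHm W /ltnSE leWm hallW.
have [small | /forallPn[i]] := boolP [forall i, #|W i| <= 1].
  have W1 i : exists x, W i = [set x].
    apply/cards1P; rewrite eqn_leq (forallP small i).
    by have := hallW [set i]; rewrite cards1 big_set1.
  have [f Wf] := fin_all_exists W1.
  exists f => [i j eq_f | i]; last by rewrite Wf set11.
  have := hallW [set i; j].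
  rewrite bigcup_setU !big_set1 !Wf eq_f setUid cards1 cards2.
  by case: eqP.
rewrite -ltnNge => /card_gt1P[x [y [Wx Wy neq_xy]]].
pose U z j := if j == i then W i :\ z else W j.
have U_neq z j : j != i -> U z j = W j by rewrite /U => /negPf->.
have U_sub z j : U z j \subset W j.
  by rewrite /U; case: eqP => [->|_] //; rewrite subsetDl.
have shrink z : z \in W i ->
    (forall Y : {set I}, #|Y| <= #|\bigcup_(j in Y) U z j|) ->
  exists2 f : I -> T, injective f & forall j, f j \in W j.
  move=> Wz /IHm[|f injf Uf].
    apply: leq_trans leWm; rewrite (bigD1 i) //= [leqRHS](bigD1 i) //=.
    rewrite /U eqxx (cardsD1 z (W i)) Wz add1n addSn ltnS leq_add2l.
    by apply: leq_sum => j /negPf->.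
  by exists f => // j; apply: subsetP (U_sub z j) _ (Uf j).
have tight z (A : {set I}) : ~~ (#|A| <= #|\bigcup_(j in A) U z j|) -> i \in A.
  apply: contraR => iA; rewrite (eq_bigr W) ?hallW // => j Aj.
  by rewrite U_neq //; apply: contraNneq iA => <-.
have [/forallP hallx | /forallPn[A ltA]] :=
    boolP [forall Y : {set I}, #|Y| <= #|\bigcup_(j in Y) U x j|].
  exact: shrink hallx.
have [/forallP hally | /forallPn[B ltB]] :=
    boolP [forall Y : {set I}, #|Y| <= #|\bigcup_(j in Y) U y j|].
  exact: shrink hally.
have Ai := tight _ _ ltA; have Bi := tight _ _ ltB.
move: ltA ltB; rewrite -!ltnNge.
set X := \bigcup_(j in A) U x j; set Z := \bigcup_(j in B) U y j => ltX ltZ.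
have leU : #|A :|: B| <= #|X :|: Z|.
  apply: leq_trans (hallW _) (subset_leq_card _).
  apply/bigcupsP=> j; have [-> _ | nji] := eqVneq j i.
    apply/subsetP=> w Ww; rewrite inE.
    (* W i is the union of W i :\ x and W i :\ y since x != y *)
    have [-> | nwx] := eqVneq w x; apply/orP; [right | left];
      by apply/bigcupP; exists i; rewrite // /U eqxx !inE ?neq_xy ?nwx.
  rewrite inE => /orP[Aj | Bj].
    by apply: subsetU; rewrite -(U_neq x j nji) bigcup_sup.
  by apply: subsetU; rewrite -(U_neq y j nji) bigcup_sup // orbT.
have leI : #|(A :&: B) :\ i| <= #|X :&: Z|.
  apply: leq_trans (hallW _) (subset_leq_card _).
  apply/bigcupsP=> j; rewrite !inE => /and3P[nji Aj Bj].
  by rewrite subsetI -{1}(U_neq x j nji) -(U_neq y j nji) !bigcup_sup.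
have := leq_add leU leI; rewrite cardsUI.
have := cardsUI A B; rewrite (cardsD1 i (A :&: B)) inE Ai Bi /= addnCA => eqAB.
rewrite -ltnS -add1n eqAB leqNgt; case/negP.
by apply: leq_trans (leq_add ltX ltZ); rewrite addSn addnS.
Qed.

Lemma sufficient_of_product (n : nat) (G : {group 'S_n}) :
  is_product_of_symmetric_groups G -> orbit_condition_sufficient G.
Proof.
case=> P partP GP V orbV.
have coverP x : x \in cover P by rewrite (cover_partition partP).
have [_ trivP _] := and3P partP.
have blockP x : pblock P x \in P by rewrite pblock_mem.
have [Y|f injf Wf] := @hall_marriage _ _ (fun i => V i :&: pblock P i).
  (* Hall's inequality is the sum over the blocks B of the same inequality
     between the traces of Y and of the union U on B. *)
  set U := \bigcup_(y in Y) _.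
  have count (D : {set 'I_n}) : #|D| = \sum_(B in P) #|D :&: B|.
    rewrite -sum1_card (eq_bigl (fun x => (x \in setT) && (x \in D))) => [|x].
      rewrite (set_partition_big_cond _ partP); apply: eq_bigr => B _.
      by rewrite -sum1_card; apply: eq_bigl => x; rewrite !inE andbC.
    by rewrite inE.
  rewrite (count Y) (count U); apply: leq_sum => B PB.
  have [->|/orbV[g Gg sgV]] := eqVneq (Y :&: B) set0; first by rewrite cards0.
  rewrite -(card_imset _ (@perm_inj _ g)); apply: subset_leq_card.
  apply/subsetP=> _ /imsetP[y YBy ->].
  have Bgy : g y \in B.
    by rewrite -((GP g).1 Gg B PB) imset_f //; case/setIP: YBy.
  rewrite inE Bgy andbT.
  have /bigcupP[z /setIP[Yz Bz] Vz] := subsetP sgV _ (imset_f g YBy).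
  apply/bigcupP; exists z => //.
  by rewrite inE Vz (def_pblock trivP PB Bz).
exists (perm injf) => [|i]; last first.
  by rewrite permE; case/setIP: (Wf i).
apply/GP => B PB; apply/eqP; rewrite eqEcard card_imset; last exact: perm_inj.
rewrite leqnn andbT; apply/subsetP=> _ /imsetP[x Bx ->]; rewrite permE.
by have /setIP[_] := Wf x; rewrite (def_pblock trivP PB Bx).
Qed.

(** Let [k] have the most fixed points among the elements of [G] that move [a],
    and suppose that it moves some [c] other than [a] and [k a].  By the choice
    of [k], an element of [G] that fixes [c] and all fixed points of [k] also
    fixes [a].  The system below forces a marriage to fix all fixed points of
    [k] and to move [a], and then excludes every remaining value at [c].  Its
    orbit condition nevertheless holds: the identity is good for a set that
    avoids [a], and [k^-1] for a set that contains [a] and otherwise only [c]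
    and fixed points of [k]; all other sets have the full union. *)
Lemma exists_tperm_sufficient (n : nat) (G : {group 'S_n})
    (a : 'I_n) (k0 : 'S_n) :
    orbit_condition_sufficient G -> k0 \in G -> k0 a != a ->
  exists2 b, b != a & tperm a b \in G.
Proof.
move=> suffG Gk0 k0a.
pose fixed (g : 'S_n) := [set x | g x == x].
have Pk0 : (k0 \in G) && (k0 a != a) by rewrite Gk0.
case: (@arg_maxnP _ k0 (fun g => (g \in G) && (g a != a))
                  (fun g => #|fixed g|) Pk0) => k /andP[Gk ka] maxk.
exists (k a) => //.
suff fix_k c : c != a -> c != k a -> k c = c.
  suff <- : k = tperm a (k a) by [].
  apply/permP=> x; case: tpermP => [-> // | -> | /eqP xa /eqP xka]; last first.
    exact: fix_k.
  apply/eqP/negPn/negP=> kka.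
  have kka' : k (k a) != k a by rewrite (inj_eq (@perm_inj _ k)).
  have /perm_inj/eqP := fix_k (k (k a)) kka kka'.
  by rewrite (negPf kka').
move=> ca cka; apply/eqP/negPn/negP => kc.
pose H := [set h in G | (fixed k \subset fixed h) && (h a != a)].
have Hc h : h \in H -> h c != c.
  rewrite inE => /and3P[Gh sfix ha]; apply: contraTneq (maxk h _) => [hc|].
    rewrite -ltnNge; apply: proper_card; apply/properP; split=> //.
    by exists c; rewrite inE ?hc.
  by rewrite Gh ha.
pose V i := if k i == i then [set i] else if i == a then [set~ a]
            else if i == c then ~: [set (h : 'S_n) c | h in H] else setT.
have Va : V a = [set~ a] by rewrite /V (negPf ka) eqxx.
have Vc : V c = ~: [set (h : 'S_n) c | h in H].
  by rewrite /V (negPf kc) (negPf ca) eqxx.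
have Vfix i : k i = i -> V i = [set i] by move=> ki; rewrite /V ki eqxx.
have [Y _ | g Gg Vg] := suffG V.
  have [/existsP[y /and4P[Yy ky ya yc]] | noY] :=
      boolP [exists y, [&& y \in Y, k y != y, y != a & y != c]].
    exists 1 => //; apply/subsetP=> x _; apply/bigcupP; exists y => //.
    by rewrite /V (negPf ky) (negPf ya) (negPf yc) inE.
  have dichY y : y \in Y -> [\/ k y = y, y = a | y = c].
    move=> Yy; move/existsPn/(_ y): noY; rewrite Yy.
    case: eqP => [|_]; first by constructor 1.
    case: eqP => [|_]; first by constructor 2.
    by case: eqP => [|_]; first by constructor 3.
  have [Ya | nYa] := boolP (a \in Y).
    (* k^-1 sends k a to a, so it keeps a out of the images of a and c. *)
    exists k^-1; first by rewrite groupV.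
    apply/subsetP=> _ /imsetP[y Yy ->]; apply/bigcupP.
    have [ky | -> | ->] := dichY y Yy.
    - by exists y => //; rewrite Vfix // -{1}ky permK set11.
    - by exists a; rewrite // Va !inE -(inj_eq (@perm_inj _ k)) permKV eq_sym.
    - by exists a; rewrite // Va !inE -(inj_eq (@perm_inj _ k)) permKV.
  exists 1 => //; apply/subsetP=> _ /imsetP[y Yy ->]; rewrite perm1.
  apply/bigcupP; exists y => //.
  have [ky | eya | ->] := dichY y Yy; first by rewrite Vfix ?set11.
    by rewrite -eya Yy in nYa.
  rewrite Vc inE; apply/imsetP=> -[h Hh /eqP].
  by rewrite eq_sym (negPf (Hc h Hh)).
have ga : g a != a by have := Vg a; rewrite Va !inE.
have := Vg c; rewrite Vc inE => /imsetP[]; exists g => //.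
rewrite inE Gg ga andbT; apply/subsetP=> x; rewrite !inE => /eqP kx.
by have := Vg x; rewrite Vfix // inE.
Qed.

Lemma tperm_trans (T : finType) (G : {group {perm T}}) (x y z : T) :
  tperm x y \in G -> tperm y z \in G -> tperm x z \in G.
Proof.
move=> Gxy Gyz; have [<- | nxz] := eqVneq x z; first by rewrite tperm1 group1.
have [-> // | nxy] := eqVneq x y.
have <- : tperm x y ^ tperm y z = tperm x z.
  by rewrite tpermJ tpermL tpermD // eq_sym.
exact: groupJ.
Qed.

(** In the system used here, a marriage [g] forces [g^-1 a] out of the class
    [C] of [a] and [g^-1 a'] into it, although these points are exchanged by
    the conjugate of [tperm a a'] under [g^-1].  The orbit condition holds
    because a set [Y] inside [C] misses the point [h a], which [h^-1] sends to
    the forbidden value [a]; for any other [Y] the identity is good, since the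
    union can miss [a'] only if [Y] avoids [C], which contains [a']. *)
Lemma tperm_orbit_sufficient (n : nat) (G : {group 'S_n})
    (a : 'I_n) (h : 'S_n) :
  orbit_condition_sufficient G -> h \in G -> tperm a (h a) \in G.
Proof.
move=> suffG Gh.
have [-> | ha] := eqVneq (h a) a; first by rewrite tperm1 group1.
have [a' neq_a'a Ga'] := exists_tperm_sufficient suffG Gh ha.
apply/negPn/negP => nGb.
pose C := [set x | tperm a x \in G].
pose V x := if x \in C then [set~ a] else [set~ a'].
have [Y _ | g Gg Vg] := suffG V.
  have [sYC | /subsetPn[y Yy nCy]] := boolP (Y \subset C).
    exists h^-1; first by rewrite groupV.
    apply/subsetP=> _ /imsetP[y Yy ->]; have Cy := subsetP sYC y Yy.
    apply/bigcupP; exists y; rewrite // /V Cy !inE.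
    rewrite -(inj_eq (@perm_inj _ h)) permKV.
    by apply: contraNneq nGb => <-; rewrite inE in Cy.
  exists 1 => //; apply/subsetP=> _ /imsetP[x Yx ->]; rewrite perm1.
  apply/bigcupP; have [exa' | nxa'] := eqVneq x a'.
    by exists x; rewrite // /V exa' !inE Ga' !inE.
  by exists y; rewrite // /V (negPf nCy) !inE.
have nCx : g^-1 a \notin C.
  by apply/negP => Cx; have := Vg (g^-1 a); rewrite /V Cx permKV !inE eqxx.
have Cx' : g^-1 a' \in C.
  apply/negPn/negP => nCx'; have := Vg (g^-1 a').
  by rewrite /V (negPf nCx') permKV !inE eqxx.
rewrite inE in Cx'; case/negP: nCx; rewrite inE; apply: (tperm_trans Cx').
by rewrite -tpermJ tpermC groupJ // groupV.
Qed.

(** Composing [g] with [tperm a (g a)] makes [a] a fixed point and keeps all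
    fixed points of [g], so [g] is reached by induction on the number of points
    that it moves. *)
Lemma mem_of_tperm_orbit (T : finType) (G : {group {perm T}}) (g : {perm T}) :
    (forall a h, h \in G -> tperm a (h a) \in G) ->
    (forall x, g x \in orbit 'P G x) ->
  g \in G.
Proof.
move=> Gt; have [m] := ubnP #|[set x | g x != x]|.
elim: m g => // m IHm g /ltnSE le_m orb_g.
have [/forallP g1 | /forallPn[a ga]] := boolP [forall x, g x == x].
  suff -> : g = 1 by rewrite group1.
  by apply/permP=> x; rewrite perm1; apply/eqP.
have /orbitP[h Gh /= def_ga] := orb_g a.
have Gtp : tperm a (g a) \in G by rewrite -def_ga; apply: Gt.
rewrite -(groupMr g Gtp); apply: IHm => [|x]; last first.
  rewrite permM; apply: orbit_trans (orb_g x).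
  by have := mem_orbit 'P (g x) Gtp.
apply: leq_trans le_m; apply: proper_card; apply/properP; split.
  apply/subsetP=> x; rewrite !inE permM; apply: contraNneq => gx.
  have nax : a != x by apply: contraNneq ga => ->; rewrite gx.
  by rewrite gx tpermD // -gx (inj_eq perm_inj).
by exists a; rewrite !inE ?permM ?tpermR ?eqxx.
Qed.

Theorem theorem1p2 (n : nat) (n_ge1 : 1 <= n) (G : {group 'S_n}) :
  orbit_condition_sufficient G <-> is_product_of_symmetric_groups G.
Proof.
split=> [suffG | ]; last exact: sufficient_of_product.
have actsG : [acts G, on [set: 'I_n] | 'P] by apply/actsP=> g _ x; rewrite !inE.
exists (orbit 'P G @: [set: 'I_n]); first exact: orbit_partition.
move=> g; split=> [Gg _ /imsetP[a _ ->] | presg].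
  apply/eqP; rewrite eqEcard card_imset; last exact: perm_inj.
  rewrite leqnn andbT; apply/subsetP=> _ /imsetP[x ax ->].
  exact: orbit_trans (mem_orbit 'P x Gg) ax.
apply: mem_of_tperm_orbit => [a h Gh | x]; first exact: tperm_orbit_sufficient.
by rewrite -(presg (orbit 'P G x)) ?imset_f ?inE ?orbit_refl.
Qed.
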